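(* Let $p>2$ be a prime. There is a constant $C>0$ such that for every ordering $\lambda$ of $\mathbb{F}_p\times\mathbb{F}_p$ the torsion growth function of the Sushchansky group $G_\lambda=\langle A,B_\lambda\rangle$ satisfies, for all $n\ge 1$, $$\pi_{G_\lambda}(n)\le C\,n^{\log_{1/\eta_r}(p)},$$ where $r=p^2$ and $\eta_r$ is the positive root of the polynomial $x^r+x^{r-1}+x^{r-2}-2$.
   Context: Tree automorphisms. Let $p>2$ be a prime and $X=\{0,1,\dots,p-1\}$, identified with the field $\mathbb{F}_p$. The set $X^*$ of finite words over $X$ is a rooted $p$-ary tree (root the empty word; $w$ is joined to $wx$). For $g\in\mathrm{Aut}\,X^*$ and $v\in X^*$, the restriction $g|_v\in \mathrm{Aut}\,X^*$ is defined by $g(vw)=g(v)\,g|_v(w)$. Write $g=(g|_0,g|_1,\dots,g|_{p-1})\pi_g$, where $\pi_g$ is the permutation of $X$ induced by $g$ (omitted if trivial). In a product $gh$, $g$ acts first. Let $\sigma=(0,1,\dots,p-1)$ be the cyclic permutation $x\mapsto x+1$ of $X$; $\sigma$ also denotes the automorphism $(1,\dots,1)\sigma$. Sushchansky groups. Let $\lambda=\{(\alpha_i,\beta_i): i=1,\dots,p^2\}$ be an ordering (enumeration without repetition) of all pairs in $\mathbb{F}_p\times\mathbb{F}_p$. Put $u_i=0$, $v_i=1$ if $\beta_i=0$, and $u_i=1$, $v_i=-\alpha_i/\beta_i$ if $\beta_i\neq 0$. Define automorphisms $q_i,r_i$ ($i=1,\dots,p^2$, indices taken modulo $p^2$) of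 $X^*$ recursively by $$q_i=(q_{i+1},\sigma^{u_i},1,\dots,1),\qquad r_i=(r_{i+1},\sigma^{v_i},1,\dots,1).$$ Let $A=(1,\sigma,\sigma^2,\dots,\sigma^{p-1})\sigma$, and let $B_\lambda$ be the automorphism acting trivially on $X^2$ with $B_\lambda|_{00}=q_1$, $B_\lambda|_{10}=r_1$, $B_\lambda|_{21}=\sigma$, and all other restrictions $B_\lambda|_{xy}$, $xy\in X^2$, trivial. The Sushchansky group of type $\lambda$ is $G_\lambda=\langle A,B_\lambda\rangle$. Torsion growth. For a torsion group $G$ with a finite generating set, $\pi_G(n)$ is the maximal order of an element of word length at most $n$; here $G_\lambda$ is taken with generating set $\{A,B_\lambda\}$. *)

(* Defs.v *)
From HB Require Import structures.
From mathcomp Require Import all_boot all_order all_fingroup all_algebra.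
From mathcomp Require Import all_classical all_reals all_analysis.
From mathcomp Require Import lra.

Set Implicit Arguments.
Unset Strict Implicit.
Unset Printing Implicit Defensive.

Import Order.TTheory GRing.Theory Num.Theory.

Local Open Scope classical_set_scope.
Local Open Scope ring_scope.

Section TreeAut.
Variable X : finType.

(* The root is [::], and w is joined to wx = rcons w x. *)
Definition tree_edge (v w : seq X) : Prop :=
  (exists x, w = rcons v x) \/ (exists x, v = rcons w x).

Definition is_tree_aut (f : seq X -> seq X) : Prop :=
  [/\ bijective f, f [::] = [::]
    & forall v w, tree_edge v w <-> tree_edge (f v) (f w)].

Record tree_aut := TreeAut {
  tree_fun :> seq X -> seq X;
  tree_autP : is_tree_aut tree_fun }.

Lemma tree_aut_eq (g h : tree_aut) : g =1 h -> g = h.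
Proof.
case: g h => [f fP] [f' f'P] /= /funext E.
by rewrite E in fP *; congr TreeAut; exact: Prop_irrelevance.
Qed.

HB.instance Definition _ := gen_eqMixin tree_aut.
HB.instance Definition _ := gen_choiceMixin tree_aut.

Lemma is_tree_aut_id : is_tree_aut id.
Proof. by split => //; exists id. Qed.

Lemma is_tree_aut_comp (f g : seq X -> seq X) :
  is_tree_aut f -> is_tree_aut g -> is_tree_aut (f \o g).
Proof.
move=> [bf f0 fe] [bg g0 ge]; split; first exact: bij_comp.
- by rewrite /= g0.
- by move=> v w; apply: (iff_trans (ge v w)); exact: fe.
Qed.

Lemma is_tree_aut_can (f g : seq X -> seq X) :
  is_tree_aut f -> cancel f g -> cancel g f -> is_tree_aut g.
Proof.
move=> [bf f0 fe] fK gK; split; first by exists f.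
- by rewrite -f0 fK.
- by move=> v w; apply: iff_sym; apply: (iff_trans (fe _ _)); rewrite !gK.
Qed.

Lemma tree_aut_inv_subproof (g : tree_aut) :
  exists h : seq X -> seq X, cancel g h /\ cancel h g.
Proof. by case: (tree_autP g) => -[h gK hK] _ _; exists h. Qed.

Definition tree_inv_fun (g : tree_aut) : seq X -> seq X :=
  projT1 (cid (tree_aut_inv_subproof g)).

Lemma tree_funK (g : tree_aut) : cancel g (tree_inv_fun g).
Proof. by rewrite /tree_inv_fun; case: cid => h []. Qed.

Lemma tree_inv_funK (g : tree_aut) : cancel (tree_inv_fun g) g.
Proof. by rewrite /tree_inv_fun; case: cid => h []. Qed.

Definition tree_one : tree_aut := TreeAut is_tree_aut_id.

(* In a product g * h the left factor g acts first. *)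
Definition tree_mul (g h : tree_aut) : tree_aut :=
  TreeAut (is_tree_aut_comp (tree_autP h) (tree_autP g)).

Definition tree_inv (g : tree_aut) : tree_aut :=
  TreeAut (is_tree_aut_can (tree_autP g) (@tree_funK g) (@tree_inv_funK g)).

Lemma tree_mulA : associative tree_mul.
Proof. by move=> g h k; apply: tree_aut_eq. Qed.
Lemma tree_1mul : left_id tree_one tree_mul.
Proof. by move=> g; apply: tree_aut_eq. Qed.
Lemma tree_mul1 : right_id tree_one tree_mul.
Proof. by move=> g; apply: tree_aut_eq. Qed.
Lemma tree_mulVg : left_inverse tree_one tree_inv tree_mul.
Proof. by move=> g; apply: tree_aut_eq => w /=; rewrite tree_inv_funK. Qed.
Lemma tree_mulgV : right_inverse tree_one tree_inv tree_mul.
Proof. by move=> g; apply: tree_aut_eq => w /=; rewrite tree_funK. Qed.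

HB.instance Definition _ := isGroup.Build tree_aut
  tree_mulA tree_1mul tree_mul1 tree_mulVg tree_mulgV.

Lemma tree_edge_nil x (w : seq X) : tree_edge [::] (x :: w) <-> w = [::].
Proof.
split=> [[[y]|[y]]|->]; last by left; exists x.
- by case: w.
- by case: w.
Qed.

Lemma tree_edge_sym (v w : seq X) : tree_edge v w -> tree_edge w v.
Proof. by case=> h; [right | left]. Qed.

Lemma tree_edge_cons x y (v w : seq X) :
  tree_edge (x :: v) (y :: w) <-> x = y /\ tree_edge v w.
Proof.
split=> [[[z]|[z]] /= [-> ->]|[-> [[z ->]|[z ->]]]].
- by split => //; left; exists z.
- by split => //; right; exists z.
- by left; exists z.
- by right; exists z.
Qed.

Definition decomp_fun (g : X -> tree_aut) (s : {perm X}) (w : seq X) : seq X :=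
  if w is x :: w' then s x :: g x w' else [::].

Lemma decomp_subproof (g : X -> tree_aut) (s : {perm X}) :
  is_tree_aut (decomp_fun g s).
Proof.
have g0 x : g x [::] = [::] by case: (tree_autP (g x)).
have gnil x w : g x w = [::] -> w = [::].
  by move=> E; apply: (can_inj (@tree_funK (g x))); rewrite E g0.
have gE x v w : tree_edge v w <-> tree_edge (g x v) (g x w).
  by case: (tree_autP (g x)).
split=> //.
  exists (fun w => if w is y :: w' then
      (s^-1)%g y :: tree_inv_fun (g ((s^-1)%g y)) w' else [::]).
  - by case=> //= x w; rewrite permK tree_funK.
  - by case=> //= x w; rewrite permKV tree_inv_funK.
have half x w : tree_edge [::] (x :: w) <-> tree_edge [::] (s x :: g x w).
  by rewrite !tree_edge_nil; split=> [->|/gnil].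
case=> [|x v] [|y w] /=; [exact: iff_refl | exact: half | |].
- by split=> /tree_edge_sym h; apply: tree_edge_sym; apply/(half x v).
- rewrite !tree_edge_cons; split=> [[<-]|[/perm_inj <-]] h; split=> //.
  + by case: (gE x v w) => + _; apply.
  + by case: (gE x v w) => _; apply.
Qed.

(* The automorphism (g x)_(x in X) s: it acts on the first letter by s, and its
   restriction at the letter x is g x. *)
Definition decomp (g : X -> tree_aut) (s : {perm X}) : tree_aut :=
  TreeAut (decomp_subproof g s).

Lemma decompE g s x w : decomp g s (x :: w) = s x :: g x w.
Proof. by []. Qed.

End TreeAut.

Section Spine.
Variables (p : nat) (I : Type) (next : I -> I).
Local Notation X := 'F_p.
Implicit Type d : I -> tree_aut X.

Fixpoint spine_fun d (i : I) (w : seq X) : seq X :=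
  if w is x :: w' then
    x :: (if x == 0 then spine_fun d (next i) w'
          else if x == 1 then d i w' else w')
  else [::].

Lemma spine_subproof d i : is_tree_aut (spine_fun d i).
Proof.
split=> //.
  exists (spine_fun (fun j => (d j)^-1%g) i).
  - move=> w; elim: w i => //= x w IH i; case: eqP => _; first by rewrite IH.
    by case: eqP => // _; rewrite tree_funK.
  - move=> w; elim: w i => //= x w IH i; case: eqP => _; first by rewrite IH.
    by case: eqP => // _; rewrite tree_inv_funK.
have d0 j : d j [::] = [::] by case: (tree_autP (d j)).
have dnil j w : d j w = [::] -> w = [::].
  by move=> E; apply: (can_inj (@tree_funK _ (d j))); rewrite E d0.
have dE j v w : tree_edge v w <-> tree_edge (d j v) (d j w).
  by case: (tree_autP (d j)).
have half j (x : X) w : tree_edge [::] (x :: w) <->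
    tree_edge [::] (spine_fun d j (x :: w)).
  rewrite /= !tree_edge_nil; case: eqP => _; first by case: w.
  by case: eqP => // _; split=> [->|/dnil].
move=> v; elim: v i => [|x v IH] i [|y w]; [exact: iff_refl | exact: half | |].
- by split=> /tree_edge_sym h; apply: tree_edge_sym;
    apply/(half i x v).
rewrite /= !tree_edge_cons; split=> -[<-] E; split=> //; move: E.
- case: eqP => _; first by case: (IH (next i) w).
  by case: eqP => // _; case: (dE i v w).
- case: eqP => _; first by case: (IH (next i) w).
  by case: eqP => // _; case: (dE i v w).
Qed.

(* The family determined by spine i = (spine (next i), d i, 1, ..., 1). *)
Definition spine d i : tree_aut X := TreeAut (spine_subproof d i).

Lemma spineE d i : spine d i =
  decomp (fun x => if x == 0 then spine d (next i)
                   else if x == 1 then d i else 1%g) 1%g.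
Proof.
apply: tree_aut_eq => -[|x w] //; rewrite decompE perm1 /=.
by case: eqP => // _; case: eqP.
Qed.

End Spine.

Section Sushchansky.
Variable p : nat.
Local Notation X := 'F_p.

Definition sigma_perm : {perm X} := perm (@addIr X 1).

Definition sigma : tree_aut X := decomp (fun=> 1%g) sigma_perm.

Definition sush_A : tree_aut X := decomp (fun x : X => (sigma ^+ x)%g) sigma_perm.

(* The positions i = 1, ..., p ^ 2, taken modulo p ^ 2, are the elements of
   'Z_(p ^ 2); lam i is the pair (alpha_i, beta_i), and an ordering is a
   bijective lam. *)
Variable lam : 'Z_(p ^ 2) -> X * X.

Definition sush_u (i : 'Z_(p ^ 2)) : X := if (lam i).2 == 0 then 0 else 1.

Definition sush_v (i : 'Z_(p ^ 2)) : X :=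
  if (lam i).2 == 0 then 1 else - (lam i).1 / (lam i).2.

Definition sush_q : 'Z_(p ^ 2) -> tree_aut X :=
  spine (fun i => i + 1) (fun i => (sigma ^+ sush_u i)%g).

Definition sush_r : 'Z_(p ^ 2) -> tree_aut X :=
  spine (fun i => i + 1) (fun i => (sigma ^+ sush_v i)%g).

Definition sush_B_restr (x y : X) : tree_aut X :=
  if (x, y) == (0, 0) then sush_q 1
  else if (x, y) == (1, 0) then sush_r 1
  else if (x, y) == (2, 1) then sigma
  else 1%g.

Definition sush_B : tree_aut X :=
  decomp (fun x => decomp (sush_B_restr x) 1%g) 1%g.

Definition sush_gens : set (tree_aut X) := [set sush_A; sush_B].

End Sushchansky.

Section TorsionGrowth.
Variables (R : realType) (G : groupType).

Definition is_subgroup (H : set G) : Prop :=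
  [/\ H 1%g, forall x y, H x -> H y -> H (x * y)%g & forall x, H x -> H x^-1%g].

Definition generated (S : set G) : set G := smallest is_subgroup S.

(* g is a product of at most n elements of S and their inverses. *)
Definition word_length_le (S : set G) (n : nat) (g : G) : Prop :=
  exists s : seq G, [/\ (size s <= n)%N,
    forall x, x \in s -> S x \/ S x^-1%g & g = (\prod_(x <- s) x)%g].

(* The least n > 0 with g ^ n = 1, and +oo if there is none. *)
Definition elt_order (g : G) : \bar R :=
  ereal_inf [set n%:R%:E | n in [set n : nat | (0 < n)%N /\ (g ^+ n)%g = 1%g]].

(* For finite S the supremum is a maximum; it is +oo as soon as an element of
   H of length at most n has infinite order. *)
Definition torsion_growth (H S : set G) (n : nat) : \bar R :=
  ereal_sup [set elt_order g | g in [set g | H g /\ word_length_le S n g]].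

End TorsionGrowth.

Definition sushchansky (p : nat) (lam : 'Z_(p ^ 2) -> 'F_p * 'F_p) :
  set (tree_aut 'F_p) := generated (sush_gens lam).

Section Eta.
Variable R : realType.

Definition eta_poly (r : nat) : {poly R} :=
  'X^r + 'X^(r - 1) + 'X^(r - 2) - 2%:P.

Definition eta (r : nat) : R := xget 0 [set x | 0 < x /\ root (eta_poly r) x].

Lemma etaP (r : nat) : (2 <= r)%N ->
  [/\ 0 < eta r, root (eta_poly r) (eta r)
    & forall x, 0 < x -> root (eta_poly r) x -> x = eta r].
Proof.
move=> r2; set P := eta_poly r.
have hE x : P.[x] = x ^+ r + x ^+ (r - 1) + x ^+ (r - 2) - 2.
  by rewrite !hornerE.
have mono x y : 0 < x -> x < y -> P.[x] < P.[y].
  move=> x0 xy; rewrite !hE ltrD2r.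
  apply: ltr_leD; first apply: ltr_leD.
  - by rewrite ltrXn2r ?ltW // -lt0n (leq_trans _ r2).
  - by apply: lerXn2r; rewrite ?nnegrE ltW // (lt_trans x0).
  - by apply: lerXn2r; rewrite ?nnegrE ltW // (lt_trans x0).
have P0 : P.[0] < 0.
  rewrite hE !expr0n.
  by case: (r) r2 => [|[|[|k]]] // _; rewrite ?subn1 ?subn2 /=; lra.
have P1 : 0 <= P.[1] by rewrite hE !expr1n; lra.
have [x /andP[x0 x1] xr] : exists2 x, x \in `[0, 1] & root P x.
  by apply: poly_ivt; rewrite ?ler01 // ltW.
have {}x0 : 0 < x.
  rewrite lt_neqAle eq_sym; have := x0; rewrite bnd_simp => ->.
  by rewrite andbT; apply: contraTneq xr => ->; rewrite rootE lt_eqF.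
have [e0 er] : 0 < eta r /\ root P (eta r).
  exact: (xgetPex 0 (P := [set x | 0 < x /\ root P x]) (ex_intro _ x (conj x0 xr))).
split=> // y y0 /rootP yr; move/rootP: er => er.
by case: (ltgtP y (eta r)) => // /mono; rewrite ?y0 ?e0 yr er ltxx => /(_ isT).
Qed.

Definition logb (b x : R) : R := ln x / ln b.

End Eta.

(* Main.v *)
(* Every element of [G_lam] acts on the second level of the tree as a power of
   [A], and its restrictions there are words in [sigma], [q_i], [r_i], so its
   [p]-th power restricts to such words of linear length. For these words we use
   the Bartholdi-Sunic weights: [b = q_i ^ b1 r_i ^ b2] becomes trivial on its
   coordinate 1 after at most [r = p ^ 2] steps down the tree, since [lam]
   enumerates all pairs, and its weight increases with the number of steps
   needed. The weights are chosen so that the restrictions of an alternating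
   word have total weight at most [eta] times its weight. An element that does
   not fix the first level has a [p]-th power whose restrictions are the
   products of all its restrictions along an orbit. Hence passing down one level
   costs a factor [p] in the order and gains a factor [eta] in the weight, while
   nontrivial words have weight bounded below. *)
Require Import Defs.
From mathcomp Require Import all_boot all_order all_fingroup all_algebra.
From mathcomp Require Import all_classical all_reals all_analysis.
From mathcomp Require Import ring lra zify.

Set Implicit Arguments.
Unset Strict Implicit.
Unset Printing Implicit Defensive.

Import Order.TTheory GRing.Theory Num.Theory.

Local Open Scope classical_set_scope.
Local Open Scope ring_scope.

(** * Generalities on tree automorphisms and on [eta] *)

Lemma tree_mulE (X : finType) (g h : tree_aut X) v : (g * h)%g v = h (g v).
Proof. by []. Qed.

Lemma tree_oneE (X : finType) v : (1%g : tree_aut X) v = v.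
Proof. by []. Qed.

Lemma tree_aut_nil (X : finType) (g : tree_aut X) : g [::] = [::].
Proof. by case: (tree_autP g). Qed.

Lemma tree_expgSr (X : finType) (g : tree_aut X) k v :
  (g ^+ k.+1)%g v = g ((g ^+ k)%g v).
Proof. by rewrite expgSr. Qed.

Lemma tree_expg_cons (X : finType) (g h : tree_aut X) x n :
  (forall v, g (x :: v) = x :: h v) ->
  forall v, (g ^+ n)%g (x :: v) = x :: (h ^+ n)%g v.
Proof.
by move=> gx v; elim: n => [|n IH]; rewrite ?expg0 // !tree_expgSr IH gx.
Qed.

Lemma tree_expg_eq1 (X : finType) (g : tree_aut X) (h : X -> tree_aut X) n :
  (forall x v, g (x :: v) = x :: h x v) ->
  (forall x, h x ^+ n = 1)%g -> (g ^+ n = 1)%g.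
Proof.
move=> gE h1; apply: tree_aut_eq => -[|x v]; first exact: tree_aut_nil.
by rewrite (tree_expg_cons _ (gE x)) h1.
Qed.

Lemma expg_mulC_eq1 (G : groupType) (g h : G) n :
  ((g * h) ^+ n = 1 -> (h * g) ^+ n = 1)%g.
Proof.
move=> gh1.
have -> : (h * g = (g * h) ^ g)%g by rewrite conjgE !mulgA mulVg mul1g.
by rewrite -conjXg gh1 conj1g.
Qed.

Lemma eta_sum (R : realType) r : (2 <= r)%N ->
  eta R r ^+ r + eta R r ^+ (r - 1) + eta R r ^+ (r - 2) = 2.
Proof.
case/(etaP R) => _ /rootP + _.
by rewrite !hornerE => /eqP; rewrite subr_eq0 => /eqP.
Qed.

Lemma eta_lt1 (R : realType) r : (2 <= r)%N -> eta R r < 1.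
Proof.
move=> r2; have := eta_sum R r2; rewrite ltNge; case: leP => // h1.
have ge1 k : 1 <= eta R r ^+ k by rewrite exprn_ege1.
by have := ge1 r; have := ge1 (r - 1)%N; have := ge1 (r - 2)%N; lra.
Qed.

(** * Words in the spinal generators *)

Section Words.
Variables (p : nat) (p_prime : prime p).
Local Notation F := 'F_p.

Lemma Fp_mulrn (a : F) : a *+ p = 0.
Proof. by rewrite -mulr_natr pchar_Fp_0 // mulr0. Qed.

Lemma sigmaX n (x : F) v : (sigma p ^+ n)%g (x :: v) = (x + n%:R) :: v.
Proof.
elim: n v => [|n IH] v; first by rewrite expg0 addr0.
by rewrite tree_expgSr IH /sigma decompE permE -addrA -mulrSr.
Qed.

Lemma sigmaF (a x : F) v : (sigma p ^+ a)%g (x :: v) = (x + a) :: v.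
Proof. by rewrite sigmaX natr_Zp. Qed.

(** Exponents in [F] are read as their representatives in [nat]; additivity survives the wrap-around
    because [sigma] has order [p]. *)
Lemma sigmaFD (a b : F) :
  (sigma p ^+ (a + b)%R = sigma p ^+ a * sigma p ^+ b)%g.
Proof.
apply: tree_aut_eq => -[|x v]; first by rewrite !tree_aut_nil.
by rewrite tree_mulE !sigmaF addrA.
Qed.

Lemma sigmaF0 : (sigma p ^+ (0 : F)%R = 1)%g. Proof. by []. Qed.

Lemma sigmaF_exp (a : F) : ((sigma p ^+ a) ^+ p = 1)%g.
Proof.
rewrite -expgnA; apply: tree_aut_eq => -[|x v]; first exact: tree_aut_nil.
by rewrite sigmaX natrM pchar_Fp_0 // mulr0 addr0.
Qed.

Variable lam : 'Z_(p ^ 2) -> F * F.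

(* The coefficient of [q_i ^ b.1 r_i ^ b.2] at the letter 1 is
   [sigma ^ (omega i b)]. *)
Definition omega (i : 'Z_(p ^ 2)) (b : F * F) : F :=
  b.1 * sush_u lam i + b.2 * sush_v lam i.

(** Taking one spine for the whole pair, instead of a product of powers of [q_i] and [r_i], reduces
    additivity in [b] to linearity of [omega]. *)
Definition beta (i : 'Z_(p ^ 2)) (b : F * F) : tree_aut F :=
  spine (fun i => i + 1) (fun i => (sigma p ^+ omega i b)%g) i.

Lemma omegaD i b c : omega i (b + c) = omega i b + omega i c.
Proof. by rewrite /omega /=; ring. Qed.

Lemma omega0 i : omega i 0 = 0.
Proof. by rewrite /omega /= !mul0r addr0. Qed.

Lemma betaE i b x v : beta i b (x :: v) =
  x :: (if x == 0 then beta (i + 1) b v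
        else if x == 1 then (sigma p ^+ omega i b)%g v else v).
Proof. by []. Qed.

Lemma betaD i b c : beta i (b + c) = (beta i b * beta i c)%g.
Proof.
apply: tree_aut_eq => v; rewrite tree_mulE.
elim: v i => [|x v IH] i; first by rewrite !tree_aut_nil.
rewrite !betaE; case: eqP => _; first by rewrite IH.
by case: eqP => // _; rewrite omegaD sigmaFD.
Qed.

Lemma beta0 i : beta i 0 = 1%g.
Proof.
apply: tree_aut_eq => v; rewrite tree_oneE.
elim: v i => [|x v IH] i //; rewrite betaE IH omega0 sigmaF0.
by case: eqP => // _; case: eqP.
Qed.

Lemma betaX i b n : (beta i b ^+ n)%g = beta i (b *+ n).
Proof. by elim: n => [|n IH]; rewrite ?beta0 // expgS IH mulrS betaD. Qed.

Lemma beta_exp i b : (beta i b ^+ p)%g = 1%g.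
Proof.
rewrite betaX -(beta0 i); congr (beta i _); case: b => b1 b2.
by apply/eqP; rewrite -pair_eqE /= !raddfMn /= !Fp_mulrn eqxx.
Qed.

Lemma betaV i b v : beta i (- b) (beta i b v) = v.
Proof. by rewrite -tree_mulE -betaD subrr beta0. Qed.

Lemma sush_qE i : sush_q lam i = beta i (1, 0).
Proof.
rewrite /sush_q /beta; congr (spine _ _ i); apply/funext => j.
by rewrite /omega mul1r mul0r addr0.
Qed.

Lemma sush_rE i : sush_r lam i = beta i (0, 1).
Proof.
rewrite /sush_r /beta; congr (spine _ _ i); apply/funext => j.
by rewrite /omega mul1r mul0r add0r.
Qed.

(* The letter [(b, e)] stands for [q_i ^ b.1 r_i ^ b.2 sigma ^ e]. *)
Local Notation word := (seq ((F * F) * F)).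

Definition word_eval (i : 'Z_(p ^ 2)) (w : word) : tree_aut F :=
  (\prod_(l <- w) (beta i l.1 * sigma p ^+ l.2))%g.

Lemma word_eval_nil i : word_eval i [::] = 1%g. Proof. exact: big_nil. Qed.

Lemma word_eval_cons i l w :
  word_eval i (l :: w) = (beta i l.1 * sigma p ^+ l.2 * word_eval i w)%g.
Proof. exact: big_cons. Qed.

Lemma word_eval_cat i w1 w2 :
  word_eval i (w1 ++ w2) = (word_eval i w1 * word_eval i w2)%g.
Proof. exact: big_cat. Qed.

Lemma word_eval_beta i b : word_eval i [:: (b, 0)] = beta i b.
Proof. by rewrite word_eval_cons word_eval_nil sigmaF0 !mulg1. Qed.

Lemma word_eval_sigma i e : word_eval i [:: (0, e)] = (sigma p ^+ e)%g.
Proof. by rewrite word_eval_cons word_eval_nil beta0 mul1g !mulg1. Qed.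

Definition exp_sum (w : word) : F := \sum_(l <- w) l.2.

Definition letter_restr i (x : F) (b : F * F) : word :=
  if x == 0 then [:: (b, 0)] else if x == 1 then [:: (0, omega i b)] else [::].

(** The [beta] factors fix the first letter and each power of [sigma] shifts it, so the tail meets
    [x + l.2]. *)
Fixpoint word_restr i (x : F) (w : word) : word :=
  if w is l :: w' then letter_restr i x l.1 ++ word_restr i (x + l.2) w'
  else [::].

Lemma word_eval_restr i w x v :
  word_eval i w (x :: v)
    = (x + exp_sum w) :: word_eval (i + 1) (word_restr i x w) v.
Proof.
elim: w x v => [|l w IH] x v.
  by rewrite /exp_sum big_nil addr0 !word_eval_nil.
rewrite word_eval_cons !tree_mulE betaE sigmaF IH /= word_eval_cat tree_mulE.
rewrite /exp_sum big_cons addrA; congr (_ :: word_eval _ _ _).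
rewrite /letter_restr; case: eqP => _; first by rewrite word_eval_beta.
by case: eqP => _; rewrite ?word_eval_sigma ?word_eval_nil.
Qed.

Lemma word_eval_expg_restr i w k x v : (word_eval i w ^+ k)%g (x :: v) =
  (x + exp_sum w *+ k) ::
    word_eval (i + 1)
      (flatten [seq word_restr i (x + exp_sum w *+ j) w | j <- iota 0 k]) v.
Proof.
elim: k => [|k IH] in v *; first by rewrite expg0 addr0 word_eval_nil.
rewrite tree_expgSr IH word_eval_restr -addrA -mulrSr.
have -> : iota 0 k.+1 = rcons (iota 0 k) k by rewrite -addn1 iotaD cats1.
by rewrite map_rcons flatten_rcons word_eval_cat.
Qed.

(** * Depth of an exponent pair *)

Local Notation r := (p ^ 2)%N.

Lemma r_gt1 : (1 < r)%N.
Proof. by rewrite expnS expn1; have := prime_gt1 p_prime; nia. Qed.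

Hypothesis lam_bij : bijective lam.

(** [sush_u] and [sush_v] are chosen so that [lam i] lies in the kernel of the linear form
    [omega i]. *)
Lemma omega_lam i : omega i (lam i) = 0.
Proof.
rewrite /omega /sush_u /sush_v; case: (lam i) => a b /=.
by case: eqP => [->|/eqP b0]; field.
Qed.

(** Surjectivity of [lam] gives [b = lam j], and [k] is the representative of [j - i] modulo [r]. *)
Lemma omega_vanishes i b : exists k, (k < r)%N && (omega (i + k%:R) b == 0).
Proof.
case: (lam_bij) => g _ gK; exists (g b - i : 'Z_r); apply/andP; split.
  by rewrite -[X in (_ < X)%N](Zp_cast r_gt1) ltn_ord.
by rewrite natr_Zp addrC subrK -[b in omega _ b]gK omega_lam.
Qed.

Lemma omega_vanishes_eventually i b : exists k, omega (i + k%:R) b == 0.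
Proof. by have [k /andP[_ kP]] := omega_vanishes i b; exists k. Qed.

(* Counted from 0: [depth i b = 0] means that [b] is trivial on the coordinate
   1 at position [i] itself. *)
Definition depth i b : nat := ex_minn (omega_vanishes_eventually i b).

Lemma depth_omega i b : omega (i + (depth i b)%:R) b = 0.
Proof. by rewrite /depth; case: ex_minnP => m /eqP. Qed.

Lemma depth_min i b k : omega (i + k%:R) b = 0 -> (depth i b <= k)%N.
Proof. by rewrite /depth; case: ex_minnP => m _ mmin /eqP/mmin. Qed.

Lemma depth_lt i b : (depth i b < r)%N.
Proof.
have [k /andP[kr /eqP/depth_min dk]] := omega_vanishes i b.
exact: leq_ltn_trans kr.
Qed.

Lemma depth_eq0 i b : (depth i b == 0)%N = (omega i b == 0).
Proof.
apply/idP/idP => [/eqP d0|/eqP o0].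
  by have := depth_omega i b; rewrite d0 addr0 => ->.
by rewrite -leqn0 depth_min // addr0.
Qed.

Lemma depthS i b : omega i b != 0 -> depth i b = (depth (i + 1) b).+1.
Proof.
move=> o0; apply/eqP; rewrite eqn_leq depth_min /=; last first.
  by rewrite -nat1r addrA depth_omega.
move: o0; rewrite -depth_eq0; case E: (depth i b) => [|d] // _.
by rewrite ltnS depth_min // -addrA nat1r -E depth_omega.
Qed.


(** * Weights *)

Variable R : realType.
Local Notation h := (eta R r).

Lemma eta_bounds : 0 < h < 1.
Proof. by have [-> _ _] := etaP R r_gt1; rewrite eta_lt1 // r_gt1. Qed.

Lemma etaX_bounds k : 0 < h ^+ k <= 1.
Proof.
by have /andP[h0 h1] := eta_bounds; rewrite exprn_gt0 // exprn_ile1 // ltW.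
Qed.

(** Normalised so that [depth_weight k + sigma_weight] is the pure power [h ^+ (r - 1 - k)]: a
    factor [h] then lowers a positive depth by one. *)
Definition sigma_weight : R := 1 - h ^+ r.

(* The equation defining [eta] says exactly that
   [depth_weight 0 + depth_weight 1 = depth_weight (r - 1)]. *)
Definition depth_weight (k : nat) : R := h ^+ r + h ^+ (r - 1 - k) - 1.

Lemma depth_weight_homo k l : (k <= l)%N -> depth_weight k <= depth_weight l.
Proof.
move=> kl; rewrite lerD2r lerD2l; have /andP[h0 h1] := eta_bounds.
by rewrite ler_wiXn2l ?ltW //; lia.
Qed.

Lemma etaXr_lt1 k : (0 < k)%N -> h ^+ k < 1.
Proof.
by move=> k0; have /andP[h0 h1] := eta_bounds; rewrite exprn_ilt1 ?ltW // -lt0n.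
Qed.

Lemma sigma_weight_gt0 : 0 < sigma_weight.
Proof. by rewrite subr_gt0 etaXr_lt1 // (ltnW r_gt1). Qed.

(** By the equation of [eta], the smallest value [depth_weight 0] equals [1 - h ^+ (r - 2)], and
    [r > 2]. *)
Lemma depth_weight_gt0 k : 0 < depth_weight k.
Proof.
apply: lt_le_trans (depth_weight_homo (leq0n k)); rewrite /depth_weight subn0.
have := eta_sum R r_gt1; have /etaXr_lt1 : (0 < r - 2)%N.
  by rewrite subn_gt0 expnS expn1; have := prime_gt1 p_prime; nia.
by lra.
Qed.

(** Of two distinct depths one is at least 1, so the sum is at least
    [depth_weight 0 + depth_weight 1], which is the maximal weight. *)
Lemma depth_weightD k l m : k != l -> (m < r)%N ->
  depth_weight m <= depth_weight k + depth_weight l.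
Proof.
have sum01 : depth_weight 0 + depth_weight 1 = depth_weight (r - 1).
  rewrite /depth_weight subn0 subnn -subnDA.
  by have := eta_sum R r_gt1; lra.
wlog: k l / (k < l)%N => [hw kl mr|kl _ mr].
  case: (ltnP k l) => [/hw|lk]; first exact.
  by rewrite addrC hw // 1?eq_sym // ltn_neqAle eq_sym kl.
have /depth_weight_homo h1 : (m <= r - 1)%N by lia.
have /depth_weight_homo h2 : (1 <= l)%N by lia.
have h3 := depth_weight_homo (leq0n k).
by lra.
Qed.

Definition beta_weight i (b : F * F) : R :=
  if b == 0 then 0 else depth_weight (depth i b).

Definition exp_weight (e : F) : R := if e == 0 then 0 else sigma_weight.

Definition weight i (w : word) : R :=
  \sum_(l <- w) (beta_weight i l.1 + exp_weight l.2).

Lemma beta_weight0 i : beta_weight i 0 = 0.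
Proof. by rewrite /beta_weight eqxx. Qed.

Lemma exp_weight0 : exp_weight 0 = 0.
Proof. by rewrite /exp_weight eqxx. Qed.

Lemma beta_weight_ge0 i b : 0 <= beta_weight i b.
Proof.
by rewrite /beta_weight; case: eqP => // _; rewrite ltW ?depth_weight_gt0.
Qed.

Lemma exp_weight_ge0 e : 0 <= exp_weight e.
Proof.
by rewrite /exp_weight; case: eqP => // _; rewrite ltW ?sigma_weight_gt0.
Qed.

(** At equal depths [omega] kills [b] and [c] at the same position, hence also [b + c], whose depth
    is no larger; distinct depths are covered by [depth_weightD]. *)
Lemma beta_weightD i b c :
  beta_weight i (b + c) <= beta_weight i b + beta_weight i c.
Proof.
have [->|b0] := eqVneq b 0; first by rewrite add0r beta_weight0 add0r.
have [->|c0] := eqVneq c 0; first by rewrite addr0 beta_weight0 addr0.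
rewrite {1}/beta_weight; case: eqP => [_|_].
  by rewrite addr_ge0 ?beta_weight_ge0.
rewrite /beta_weight (negbTE b0) (negbTE c0).
have [d|d] := eqVneq (depth i b) (depth i c); last first.
  by rewrite depth_weightD ?depth_lt.
apply: (@le_trans _ _ (depth_weight (depth i b))).
  by apply/depth_weight_homo/depth_min; rewrite omegaD {2}d !depth_omega addr0.
by rewrite lerDl ltW ?depth_weight_gt0.
Qed.

Lemma exp_weightD e f : exp_weight (e + f) <= exp_weight e + exp_weight f.
Proof.
have [->|e0] := eqVneq e 0; first by rewrite add0r exp_weight0 add0r.
apply: (@le_trans _ _ (exp_weight e)); last by rewrite lerDl exp_weight_ge0.
rewrite /exp_weight (negbTE e0); case: eqP => // _.
by rewrite ltW ?sigma_weight_gt0.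
Qed.

Lemma letter_weight_le2 i l : beta_weight i l.1 + exp_weight l.2 <= 2.
Proof.
have b1 : beta_weight i l.1 <= 1.
  rewrite /beta_weight; case: eqP => // _; rewrite /depth_weight.
  have /andP[_] := etaX_bounds r.
  by have /andP[_] := etaX_bounds (r - 1 - depth i l.1); lra.
have e1 : exp_weight l.2 <= 1.
  rewrite /exp_weight; case: eqP => // _; rewrite /sigma_weight.
  by have /andP[] := etaX_bounds r; lra.
by lra.
Qed.

Lemma weight_nil i : weight i [::] = 0. Proof. exact: big_nil. Qed.

Lemma weight_cons i l w :
  weight i (l :: w) = beta_weight i l.1 + exp_weight l.2 + weight i w.
Proof. exact: big_cons. Qed.

Lemma weight_cat i w1 w2 : weight i (w1 ++ w2) = weight i w1 + weight i w2.
Proof. exact: big_cat. Qed.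

Lemma weight_ge0 i w : 0 <= weight i w.
Proof.
rewrite sumr_ge0 // => l _.
by rewrite addr_ge0 ?beta_weight_ge0 ?exp_weight_ge0.
Qed.

Lemma weight_le_size i w : weight i w <= 2 * (size w)%:R.
Proof.
elim: w => [|l w IH]; first by rewrite weight_nil mulr0.
rewrite weight_cons /= -[(size w).+1%:R]nat1r mulrDr mulr1.
by rewrite lerD // letter_weight_le2.
Qed.

(* A letter [(b, e)] with [e <> 0] contributes [b] to the restriction at one
   vertex and [sigma ^ omega i b] at another one. If [omega i b <> 0] the depth
   of [b] decreases, and otherwise the second contribution is trivial. *)
Lemma letter_weight_restr i b : b != 0 ->
  beta_weight (i + 1) b + exp_weight (omega i b)
    <= h * (beta_weight i b + sigma_weight).
Proof.
move=> b0; rewrite /beta_weight (negbTE b0) /exp_weight.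
have add_sigma k : depth_weight k + sigma_weight = h ^+ (r - 1 - k).
  by rewrite /depth_weight /sigma_weight; ring.
rewrite add_sigma -exprS; case: ifPn => [ om|om].
  move: (om); rewrite -depth_eq0 => /eqP ->; rewrite addr0 subn0.
  have -> : (r - 1).+1 = r by have := r_gt1; lia.
  have -> : h ^+ r = depth_weight (r - 1) by rewrite /depth_weight subnn; ring.
  by rewrite depth_weight_homo // -ltnS; have := depth_lt (i + 1) b; lia.
rewrite (depthS om); have d := depth_lt i b; rewrite (depthS om) in d.
have -> : (r - 1 - (depth (i + 1) b).+1).+1 = (r - 1 - depth (i + 1) b)%N.
  by rewrite subnSK // ltn_subRL add1n.
by rewrite /depth_weight /sigma_weight; lra.
Qed.

Lemma sum_letter_restr i b :
  \sum_x weight (i + 1) (letter_restr i x b)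
    = beta_weight (i + 1) b + exp_weight (omega i b).
Proof.
rewrite (bigD1 0) //= (bigD1 1) /= ?oner_neq0 // big1 ?addr0.
  rewrite /letter_restr eqxx oner_eq0 eqxx !weight_cons !weight_nil.
  by rewrite beta_weight0 exp_weight0 !addr0 add0r.
move=> x /andP[x0 x1].
by rewrite /letter_restr (negbTE x0) (negbTE x1) weight_nil.
Qed.

(** Each letter has its own nontrivial power of [sigma], which pays for [letter_weight_restr]. The
    shift seen by the tail disappears on summing over all [x]. *)
Lemma sum_weight_restr i w : all (fun l => (l.1 != 0) && (l.2 != 0)) w ->
  \sum_x weight (i + 1) (word_restr i x w) <= h * weight i w.
Proof.
elim: w => [|l w IH] /=.
  by move=> _; rewrite big1 ?weight_nil ?mulr0 // => x _; rewrite weight_nil.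
case/andP=> /andP[b0 e0] /IH {}IH.
under eq_bigr do rewrite weight_cat.
rewrite big_split /= sum_letter_restr weight_cons mulrDr lerD //.
  by rewrite {2}/exp_weight (negbTE e0) letter_weight_restr.
by rewrite (reindex_inj (addIr l.2)) in IH.
Qed.

Lemma weight_flatten i (ws : seq word) :
  weight i (flatten ws) = \sum_(w <- ws) weight i w.
Proof.
elim: ws => [|w ws IH]; first by rewrite big_nil weight_nil.
by rewrite big_cons weight_cat IH.
Qed.

(** For [s != 0] the orbit [x + s *+ j] meets every element of [F] exactly once. *)
Lemma weight_orbit_restr i w x (s : F) : s != 0 ->
  weight (i + 1) (flatten [seq word_restr i (x + s *+ j) w | j <- iota 0 p])
    = \sum_y weight (i + 1) (word_restr i y w).
Proof.
move=> s0; rewrite weight_flatten big_map.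
rewrite -{1}(subn0 p) -/(index_iota 0 p) big_mkord.
have orbit_inj : injective (fun j : 'I_p => x + s *+ j).
  move=> j k /addrI.
  rewrite -[s *+ j]mulr_natr -[s *+ k]mulr_natr => /(mulfI s0).
  move/(congr1 (@nat_of_ord _)); rewrite !val_Fp_nat // !modn_small //.
  exact: val_inj.
rewrite (reindex _ (onW_bij _ (inj_card_bij orbit_inj _))) //.
by rewrite card_Fp // card_ord.
Qed.

(** * Light words are trivial; induction on the weight *)

Definition min_weight : R := Num.min sigma_weight (depth_weight 0).

Lemma min_weight_gt0 : 0 < min_weight.
Proof. by rewrite lt_min sigma_weight_gt0 ?depth_weight_gt0. Qed.

Lemma min_weight_le_beta i b : b != 0 -> min_weight <= beta_weight i b.
Proof.
move=> b0; rewrite /beta_weight (negbTE b0) ge_min.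
by rewrite (depth_weight_homo (leq0n _)) orbT.
Qed.

Lemma min_weight_le_exp e : e != 0 -> min_weight <= exp_weight e.
Proof. by move=> e0; rewrite /exp_weight (negbTE e0) ge_min lexx. Qed.

Lemma word_eval_light i w : weight i w < min_weight -> word_eval i w = 1%g.
Proof.
elim: w => [|[b e] w IH]; first by rewrite word_eval_nil.
rewrite weight_cons word_eval_cons /=.
have W0 := weight_ge0 i w.
have B0 := beta_weight_ge0 i b.
have E0 := exp_weight_ge0 e => small.
have [b0|b0] := eqVneq b 0; last first.
  by exfalso; have := min_weight_le_beta i b0; lra.
have [e0|e0] := eqVneq e 0; last first.
  by exfalso; have := min_weight_le_exp e0; lra.
by rewrite IH ?b0 ?e0 ?beta0 ?sigmaF0 ?mulg1 //; lra.
Qed.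

(** If the exponent sum is zero, the first level is fixed and each restriction is bounded by the
    total weight. Otherwise the [p]-th power restricts to products over a full orbit, of exactly the
    total weight. *)
Lemma word_eval_expg_reduced n i w :
  (forall w', weight (i + 1) w' <= h * weight i w ->
     (word_eval (i + 1) w' ^+ n = 1)%g) ->
  all (fun l => (l.1 != 0) && (l.2 != 0)) w ->
  (word_eval i w ^+ (p * n) = 1)%g.
Proof.
move=> IH red; have sumW := sum_weight_restr i red.
have [s0|s0] := eqVneq (exp_sum w) 0.
  rewrite mulnC expgnA.
  rewrite (@tree_expg_eq1 _ (word_eval i w)
    (fun x => word_eval (i + 1) (word_restr i x w))) ?expg1n //.
    by move=> x v; rewrite word_eval_restr // s0 addr0.
  move=> x; apply: IH; apply: le_trans sumW; rewrite (bigD1 x) //= lerDl.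
  by rewrite sumr_ge0 // => y _; rewrite weight_ge0.
rewrite expgnA; apply: (@tree_expg_eq1 _ _ (fun x => word_eval (i + 1)
    (flatten [seq word_restr i (x + exp_sum w *+ j) w | j <- iota 0 p])))
  => [x v|x].
  by rewrite word_eval_expg_restr // Fp_mulrn // addr0.
by apply: IH; rewrite weight_orbit_restr.
Qed.

Lemma word_eval_rot i w1 w2 n :
  (word_eval i (w2 ++ w1) ^+ n = 1)%g -> (word_eval i (w1 ++ w2) ^+ n = 1)%g.
Proof. by rewrite !word_eval_cat; exact: expg_mulC_eq1. Qed.

Lemma word_eval_merge_beta i b l w :
  word_eval i ((b, 0) :: l :: w) = word_eval i ((b + l.1, l.2) :: w).
Proof. by rewrite !word_eval_cons /= betaD // sigmaF0 mulg1 !mulgA. Qed.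

Lemma word_eval_merge_sigma i l e w :
  word_eval i (l :: (0, e) :: w) = word_eval i ((l.1, l.2 + e) :: w).
Proof. by rewrite !word_eval_cons /= sigmaFD // beta0 // mul1g !mulgA. Qed.

(* A cyclic word that is not alternating can be shortened, up to conjugation,
   by merging two consecutive letters. *)
Lemma word_eval_expg_unreduced n i w :
  (forall w', (size w' < size w)%N -> weight i w' <= weight i w ->
     (word_eval i w' ^+ (p * n) = 1)%g) ->
  ~~ all (fun l => (l.1 != 0) && (l.2 != 0)) w ->
  (word_eval i w ^+ (p * n) = 1)%g.
Proof.
move=> IH /allPn[[b e] lw]; case/splitPr: lw IH => w1 w2 IH.
(* A rotation brings the offending letter to the front. *)
rewrite negb_and !negbK /= => be0; apply: word_eval_rot; rewrite cat_cons.
move: IH.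
rewrite weight_cat addrC -weight_cat size_cat addnC -size_cat cat_cons.
move: (w2 ++ w1) => {w1 w2}w IH; case/orP: be0 => /eqP z; subst.
(* If [b = 0], the letter is a power of [sigma] and merges into its cyclic predecessor, the last
   letter; if it is alone, its [p]-th power is trivial. *)
- case/lastP: w IH => [|w l] IH.
    by rewrite word_eval_sigma // expgnA sigmaF_exp // expg1n.
  rewrite -rcons_cons -cats1; apply: word_eval_rot.
  rewrite /= word_eval_merge_sigma.
  apply: IH; first by rewrite /= size_rcons.
  rewrite -cats1 !(weight_cons, weight_cat) weight_nil beta_weight0 /=.
  by have := exp_weightD l.2 e; lra.
(* If [e = 0], the letter merges into its successor. *)
- case: w IH => [|l w] IH.
    by rewrite word_eval_beta expgnA beta_exp // expg1n.
  rewrite word_eval_merge_beta; apply: IH => //.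
  rewrite !weight_cons exp_weight0 /=.
  by have := beta_weightD i b l.1; lra.
Qed.

(** The outer induction on [m] descends the tree. The inner one is on the size, since merging
    letters shortens a word but need not lower its weight. *)
Lemma word_eval_expg_eq1 m i w :
  weight i w * h ^+ m < min_weight -> (word_eval i w ^+ (p ^ m.+1) = 1)%g.
Proof.
elim: m i w => [|m IHm] i w.
  by rewrite mulr1 => /word_eval_light ->; rewrite expg1n.
have /andP[h0 h1] := eta_bounds.
have [k] := ubnP (size w); elim: k w => // k IHk w /ltnSE wk small.
rewrite expnS.
have [red|red] := boolP (all (fun l => (l.1 != 0) && (l.2 != 0)) w).
  apply: word_eval_expg_reduced red => w' w'w.
  apply: IHm; apply: le_lt_trans small.
  by rewrite exprS mulrA [X in _ <= X * _]mulrC ler_wpM2r // exprn_ge0 // ltW.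
apply: word_eval_expg_unreduced red => w' ww' w'w; rewrite -expnS; apply: IHk.
  exact: leq_trans wk.
by apply: le_lt_trans small; rewrite ler_wpM2r // exprn_ge0 // ltW.
Qed.

(** * Restriction to the second level *)

Hypothesis p_gt2 : (2 < p)%N.

Lemma two_neq0 : 2 != 0 :> F.
Proof.
by apply/eqP => /(congr1 (@nat_of_ord _)); rewrite val_Fp_nat // modn_small.
Qed.

(* [g] acts on the second level as [A ^ s], which maps [x :: y :: v] to
   [(x + s) :: (y + s x + s (s - 1) / 2) :: v]. *)
Definition acts_as (g : tree_aut F) (n : nat) (s : F) : Prop :=
  (forall x, g [:: x] = [:: x + s]) /\
  exists f : F -> F -> word, forall x y, (size (f x y) <= n)%N /\
    forall v, g (x :: y :: v) =
      [:: x + s, y + s * x + s * (s - 1) / 2 & word_eval 1 (f x y) v].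

Lemma acts_as1 : acts_as 1%g 0 0.
Proof.
split=> [x|]; first by rewrite addr0.
exists (fun _ _ => [::]) => x y; split=> // v.
by rewrite word_eval_nil addr0 !mul0r !addr0.
Qed.

(** The second-letter formula is that of powers of [A], hence compatible with products; the
    restrictions concatenate, the second one taken at the image vertex. *)
Lemma acts_asM g k n m s t :
  acts_as g n s -> acts_as k m t -> acts_as (g * k)%g (n + m) (s + t).
Proof.
move=> [g1 [f fP]] [k1 [f' f'P]]; split=> [x|].
  by rewrite tree_mulE g1 k1 addrA.
exists (fun x y => f x y ++ f' (x + s) (y + s * x + s * (s - 1) / 2)) => x y.
have [fn fE] := fP x y.
have [f'm f'E] := f'P (x + s) (y + s * x + s * (s - 1) / 2).
split=> [|v]; first by rewrite size_cat leq_add.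
rewrite tree_mulE fE f'E word_eval_cat tree_mulE addrA; congr [:: _, _ & _].
by field; exact: two_neq0.
Qed.

Lemma acts_asX g n s k : acts_as g n s -> acts_as (g ^+ k)%g (k * n) (s *+ k).
Proof.
move=> gs; elim: k => [|k IH]; first exact: acts_as1.
by rewrite expgS mulrS mulSn; apply: acts_asM.
Qed.

Lemma tree_inv_eq (g : tree_aut F) u v : g u = v -> (g^-1)%g v = u.
Proof. by move=> <-; exact: tree_funK. Qed.

Lemma sush_AE x y v : sush_A p [:: x, y & v] = [:: x + 1, y + x & v].
Proof. by rewrite /sush_A decompE permE sigmaF. Qed.

Lemma sush_A1 x : sush_A p [:: x] = [:: x + 1].
Proof. by rewrite /sush_A decompE permE tree_aut_nil. Qed.

Lemma acts_as_A : acts_as (sush_A p) 1 1.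
Proof.
split=> [x|]; first exact: sush_A1.
exists (fun _ _ => [::]) => x y; split=> // v.
by rewrite sush_AE word_eval_nil subrr mulr0 mul0r addr0 mul1r.
Qed.

Lemma acts_as_AV : acts_as (sush_A p)^-1%g 1 (- 1).
Proof.
split=> [x|]; first by apply: tree_inv_eq; rewrite sush_A1 subrK.
exists (fun _ _ => [::]) => x y; split=> // v.
apply: tree_inv_eq; rewrite sush_AE word_eval_nil subrK; congr [:: _, _ & _].
by field; exact: two_neq0.
Qed.

(** The value [c = 1] serves for [B] and [c = -1] for its inverse. *)
Definition B_restr_word (c x y : F) : word :=
  if (x, y) == (0, 0) then [:: ((c, 0), 0)]
  else if (x, y) == (1, 0) then [:: ((0, c), 0)]
  else if (x, y) == (2, 1) then [:: (0, c)]
  else [::].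

Lemma sush_BE x y v :
  sush_B lam [:: x, y & v] = [:: x, y & word_eval 1 (B_restr_word 1 x y) v].
Proof.
rewrite /sush_B !decompE !perm1 /sush_B_restr /B_restr_word.
congr [:: _, _ & _]; case: ifP => _; first by rewrite word_eval_beta sush_qE.
case: ifP => _; first by rewrite word_eval_beta sush_rE.
case: ifP => _; last by rewrite word_eval_nil.
by rewrite word_eval_sigma.
Qed.

Lemma sush_B1 x : sush_B lam [:: x] = [:: x].
Proof. by rewrite /sush_B decompE perm1 tree_aut_nil. Qed.

Lemma B_restr_wordV x y v :
  word_eval 1 (B_restr_word 1 x y) (word_eval 1 (B_restr_word (- 1) x y) v) = v.
Proof.
have betaNV c : beta 1 c (beta 1 (- c) v) = v by rewrite -{1}[c]opprK betaV.
rewrite /B_restr_word; case: ifP => _.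
  rewrite !word_eval_beta -[RHS](betaNV (1, 0)).
  by congr (beta _ _ (beta _ _ _)); congr (_, _); rewrite oppr0.
case: ifP => _.
  rewrite !word_eval_beta -[RHS](betaNV (0, 1)).
  by congr (beta _ _ (beta _ _ _)); congr (_, _); rewrite oppr0.
case: ifP => _; last by rewrite word_eval_nil.
by rewrite !word_eval_sigma // -tree_mulE -sigmaFD // addNr.
Qed.

Lemma size_B_restr_word c x y : (size (B_restr_word c x y) <= 1)%N.
Proof. by rewrite /B_restr_word; do 3?case: ifP. Qed.

Lemma acts_as_B : acts_as (sush_B lam) 1 0.
Proof.
split=> [x|]; first by rewrite sush_B1 addr0.
exists (B_restr_word 1) => x y; split=> [|v]; first exact: size_B_restr_word.
by rewrite sush_BE !mul0r !addr0.
Qed.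

Lemma acts_as_BV : acts_as (sush_B lam)^-1%g 1 0.
Proof.
split=> [x|]; first by apply: tree_inv_eq; rewrite sush_B1 addr0.
exists (B_restr_word (- 1)) => x y.
split=> [|v]; first exact: size_B_restr_word.
by apply: tree_inv_eq; rewrite !mul0r !addr0 sush_BE B_restr_wordV.
Qed.

Lemma word_length_acts_as n g :
  word_length_le (sush_gens lam) n g -> exists s, acts_as g n s.
Proof.
move=> [gs [gsn gsS ->]].
have {gsS} : exists s, acts_as (\prod_(x <- gs) x)%g (size gs) s.
  elim: gs gsS {gsn} => [|x gs IH] gsS.
    by exists 0; rewrite big_nil; exact: acts_as1.
  have [s ss] : exists s, acts_as (\prod_(x <- gs) x)%g (size gs) s.
    by apply: IH => z zgs; apply: gsS; rewrite inE zgs orbT.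
  have [t xt] : exists t, acts_as x 1 t.
    have [[->|->]|[xV|xV]] := gsS x (mem_head _ _).
    - by exists 1; exact: acts_as_A.
    - by exists 0; exact: acts_as_B.
    - by exists (- 1); rewrite -[x]invgK xV; exact: acts_as_AV.
    - by exists 0; rewrite -[x]invgK xV; exact: acts_as_BV.
  by exists (t + s); rewrite big_cons; exact: (acts_asM xt ss).
move=> [s [g1 [f fP]]]; exists s; split=> //; exists f => x y.
by have [fn fE] := fP x y; split=> //; exact: leq_trans gsn.
Qed.

(** Since [s *+ p = 0], [g ^+ p] fixes the second level; its restrictions there have at most [p * n]
    letters, each of weight at most 2. *)
Lemma sush_expg_eq1 n m g : word_length_le (sush_gens lam) n g ->
  2 * (p * n)%:R * h ^+ m < min_weight -> (g ^+ (p ^ m.+2) = 1)%g.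
Proof.
move=> /word_length_acts_as[s /(acts_asX p)]; rewrite Fp_mulrn //.
move=> [g1 [f fP]] small; rewrite expnS expgnA.
have wordX x y : (word_eval 1%R (f x y) ^+ (p ^ m.+1) = 1)%g.
  apply: word_eval_expg_eq1; apply: le_lt_trans small.
  have /andP[h0 _] := eta_bounds.
  apply: ler_wpM2r; first by rewrite exprn_ge0 // ltW.
  apply: le_trans (weight_le_size _ _) _.
  by rewrite ler_pM2l // ler_nat; case: (fP x y).
apply: tree_aut_eq => -[|x [|y v]]; first exact: tree_aut_nil.
  by elim: (p ^ m.+1)%N => [|k IH]; rewrite ?expg0 // tree_expgSr IH g1 addr0.
rewrite -[RHS]/[:: x, y & (1%g : tree_aut F) v] -(wordX x y) {wordX}.
elim: (p ^ m.+1)%N => [|k IH]; first by rewrite !expg0.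
rewrite !tree_expgSr IH; have [_ ->] := fP x y.
by rewrite !mul0r !addr0.
Qed.

End Words.

(** * From exponents to the growth bound *)

Lemma elt_order_le (R : realType) (G : groupType) (g : G) n :
  (0 < n)%N -> (g ^+ n = 1)%g -> (elt_order R g <= n%:R%:E)%E.
Proof. by move=> n0 gn; apply: ereal_inf_lbound; exists n. Qed.

(** Take [m = k + 1] with [k] the integer part of the logarithm of [x] in base [1 / h]; rounding up
    costs the factor [q]. *)
Lemma geometric_exponent (R : realType) (h x : R) (q : nat) :
  0 < h < 1 -> 1 <= x -> (1 < q)%N ->
  exists2 m, x * h ^+ m < 1 & (q ^ m)%:R <= q%:R * x `^ logb (1 / h) q%:R.
Proof.
move=> /andP[h0 h1] x1 q1; have x0 : 0 < x by exact: lt_le_trans x1.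
have q0 : 0 < q%:R :> R by rewrite ltr0n ltnW.
have lnh : ln h < 0 by rewrite ln_lt0 // h0.
have L0 : 0 < - ln h by rewrite oppr_gt0.
have lx : 0 <= ln x / - ln h by rewrite divr_ge0 ?ln_ge0 // ltW.
have lq : 0 <= ln q%:R :> R by rewrite ln_ge0 // ler1n ltnW.
have /andP[lo up] := truncn_itv lx; set k := Num.truncn _ in lo up.
exists k.+1.
  rewrite -ltr_ln ?posrE ?mulr_gt0 ?exprn_gt0 // ln1.
  rewrite lnM ?posrE ?exprn_gt0 // lnXn //.
  by move: up; rewrite ltr_pdivrMr // -mulr_natr; lra.
rewrite expnS natrM ler_pM2l // natrX -(powR_mulrn _ (ltW q0)).
rewrite /logb div1r lnV ?posrE //.
rewrite /powR !gt_eqF // ler_expR.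
have -> : ln q%:R / - ln h * ln x = ln x / - ln h * ln q%:R by ring.
by rewrite ler_wpM2r.
Qed.

Theorem theorem17 (R : realType) (p : nat) (p_prime : prime p) (p_gt2 : (2 < p)%N) :
  exists2 C : R, 0 < C &
    forall lam : 'Z_(p ^ 2) -> 'F_p * 'F_p, bijective lam ->
    forall n : nat, (1 <= n)%N ->
      (torsion_growth R (sushchansky lam) (sush_gens lam) n
         <= (C * n%:R `^ logb (1 / eta R (p ^ 2)) p%:R)%:E)%E.
Proof.
have c0 := min_weight_gt0 p_prime R; set c := min_weight p R in c0.
(* [2 * p / c] turns the weight condition into [K * n * h ^+ m < 1]; the maximum with 1 ensures
   [1 <= K * n]. *)
set a := logb _ _; set K : R := Num.max 1 (2 * p%:R / c).
have K1 : 1 <= K by rewrite le_max lexx.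
have K0 : 0 < K by exact: lt_le_trans K1.
have p0 : 0 < p%:R :> R by rewrite ltr0n prime_gt0.
(* Two factors [p] come from the exponent [m + 2], the third from rounding [m] up. *)
exists (p%:R ^+ 3 * K `^ a); first by rewrite mulr_gt0 ?exprn_gt0 ?powR_gt0.
move=> lam lam_bij n n1; apply: ge_ereal_sup => _ [g [_ gn] <-].
have Kn1 : 1 <= K * n%:R by rewrite mulr_ege1 // ler1n.
have [m small pm] :=
  geometric_exponent (eta_bounds p_prime R) Kn1 (prime_gt1 p_prime).
have /andP[h0 _] := eta_bounds p_prime R.
apply: (@le_trans _ _ (p ^ m.+2)%:R%:E).
  apply: elt_order_le; first by rewrite expn_gt0 prime_gt0.
  apply: (sush_expg_eq1 p_prime lam_bij (R := R) p_gt2 gn).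
  rewrite -/c natrM -[c]mulr1 mulrA -lter_pdivrMl // mulrA mulrA.
  apply: le_lt_trans small.
  apply: ler_wpM2r; first by rewrite exprn_ge0 // ltW.
  by apply: ler_wpM2r; rewrite // mulrC le_max lexx orbT.
rewrite lee_fin !expnS 2!natrM.
have -> : p%:R ^+ 3 * K `^ a * n%:R `^ a
    = p%:R * (p%:R * (p%:R * (K * n%:R) `^ a)) :> R.
  by rewrite powRM ?ler0n // ?ltW //; ring.
by rewrite !ler_pM2l.
Qed.
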